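(* Every $2$-nilpotent Moufang loop is $3$-supernilpotent.
   Context: A loop is an algebra $(Q,\cdot,\backslash,/,1)$ in which $1$ is a two-sided identity for $\cdot$, $a\backslash b$ is the unique solution $x$ of $ax=b$, and $b/a$ is the unique solution $x$ of $xa=b$. A loop is Moufang if it satisfies the identity $x(y(xz))=((xy)x)z$. The center $Z(Q)$ of a loop $Q$ is the (normal) subloop of all elements that commute with all elements of $Q$ and associate with all pairs of elements of $Q$ (in every position). A loop $Q$ is $2$-nilpotent if $Q/Z(Q)$ is an abelian group. A polynomial on an algebra $A$ is a term in the language of $A$ expanded by all elements of $A$ as constants. An $n$-ary polynomial $p$ on $A$ is absorbing at $(e_1,\dots,e_n)\in A^n$ into $e\in A$ if $p(a_1,\dots,a_n)=e$ whenever $a_1,\dots,a_n\in A$ satisfy $a_i=e_i$ for at least one $i$. The algebra $A$ is $k$-supernilpotent if all polynomials on $A$ in at least $k+1$ variables that are absorbing (at any tuple and into any element) are constant (as functions). *)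

(* Defs.v *)
From mathcomp Require Import all_boot.
From mathcomp Require Import boolp classical_sets.

Set Implicit Arguments.
Unset Strict Implicit.
Unset Printing Implicit Defensive.

Local Open Scope classical_set_scope.

Declare Scope loop_scope.
Delimit Scope loop_scope with L.
Local Open Scope loop_scope.

(* [ldiv a b] is a \ b and [rdiv b a] is b / a. *)
Record loop := Loop {
  loop_sort :> Type;
  mul : loop_sort -> loop_sort -> loop_sort;
  ldiv : loop_sort -> loop_sort -> loop_sort;
  rdiv : loop_sort -> loop_sort -> loop_sort;
  one : loop_sort;
  mul1x : left_id one mul;
  mulx1 : right_id one mul;
  ldivP : forall a b x, mul a x = b <-> x = ldiv a b;
  rdivP : forall a b x, mul x a = b <-> x = rdiv b a }.

Arguments one {l}.

Notation "x * y" := (mul x y) : loop_scope.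
Notation "1" := one : loop_scope.

Definition moufang (Q : loop) : Prop :=
  forall x y z : Q, x * (y * (x * z)) = ((x * y) * x) * z.

Definition abelian_group (Q : loop) : Prop :=
  associative (@mul Q) /\ commutative (@mul Q).

Definition center (Q : loop) : set Q :=
  [set c | (forall x, c * x = x * c) /\
           (forall x y, [/\ c * (x * y) = (c * x) * y,
                            x * (c * y) = (x * c) * y &
                            x * (y * c) = (x * y) * c])].

(* The quotient Q / Z(Q): its elements are the cosets xZ(Q), and its operations
   are the elementwise operations on subsets of Q. *)
Definition coset (Q : loop) (x : Q) : set Q := [set x * c | c in @center Q].

Definition center_cosets (Q : loop) : Type := {A : set Q | exists x, A = coset x}.

Section CenterQuotient.
Variable Q : loop.
Implicit Types (a b c x y z : Q) (A B C : center_cosets Q).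

Lemma mulKl a x : ldiv a (a * x) = x.
Proof. by symmetry; apply/ldivP. Qed.

Lemma ldivK a b : a * ldiv a b = b.
Proof. exact/ldivP. Qed.

Lemma rdivK a b : rdiv b a * a = b.
Proof. exact/rdivP. Qed.

Lemma mulIl a x y : a * x = a * y -> x = y.
Proof. by move=> /ldivP ->; rewrite mulKl. Qed.

Lemma mulrK a x : rdiv (x * a) a = x.
Proof. by symmetry; apply/rdivP. Qed.

Lemma center1 : @center Q 1.
Proof.
by split=> [x|x y]; [rewrite mul1x mulx1 | split; rewrite ?mul1x ?mulx1].
Qed.

Lemma centerM c d : center c -> center d -> center (c * d).
Proof.
move=> [cC cA] [dC dA].
have cl x y : c * (x * y) = (c * x) * y by case: (cA x y).
have cm x y : x * (c * y) = (x * c) * y by case: (cA x y).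
have dl x y : d * (x * y) = (d * x) * y by case: (dA x y).
have dm x y : x * (d * y) = (x * d) * y by case: (dA x y).
have dr x y : x * (y * d) = (x * y) * d by case: (dA x y).
split=> [x|x y]; first by rewrite -cl dC cl cC -cm.
split.
- by rewrite -!cl -dl.
- by rewrite -cl cm dm dr.
- by rewrite !dr; congr (_ * d); case: (cA x y).
Qed.

Lemma center_ldiv c d : center c -> center d -> center (ldiv c d).
Proof.
move=> [cC cA] [dC dA]; set w := ldiv c d.
have cw : c * w = d by exact: ldivK.
have cl x y : c * (x * y) = (c * x) * y by case: (cA x y).
have cm x y : x * (c * y) = (x * c) * y by case: (cA x y).
have cwl x : c * (w * x) = d * x by rewrite cl cw.
have cwr x : c * (x * w) = x * d by rewrite cl cC -cm cw.
split=> [x|x y]; first by apply: (@mulIl c); rewrite cwl cwr dC.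
have [dl dm dr] := dA x y.
split; apply: (@mulIl c).
- by rewrite cwl !cl cw.
- by rewrite (cl x) cC -cm cwl cl cwr.
- by rewrite cwr (cl x) cC -cm cwr.
Qed.

Lemma center_rdiv c d : center c -> center d -> center (rdiv d c).
Proof.
move=> cZ dZ; suff -> : rdiv d c = ldiv c d by exact: center_ldiv.
symmetry; apply/rdivP; have [cC _] := cZ.
by rewrite -cC ldivK.
Qed.

Lemma mul_center x y c d : center c -> center d ->
  (x * c) * (y * d) = (x * y) * (c * d).
Proof.
move=> [cC cA] [dC dA].
have [_ cm _] := cA x (y * d); rewrite -cm.
have [-> _ _] := cA y d; rewrite cC.
have [_ _ ->] := dA x (y * c).
have [_ _ ->] := cA x y.
by have [_ _ ->] := dA (x * y) c.
Qed.

Lemma ldiv_center x y c d : center c -> center d ->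
  ldiv (x * c) (y * d) = ldiv x y * ldiv c d.
Proof.
move=> cZ dZ; symmetry; apply: (proj1 (ldivP _ _ _)).
by rewrite mul_center ?ldivK //; exact: center_ldiv.
Qed.

Lemma rdiv_center x y c d : center c -> center d ->
  rdiv (y * d) (x * c) = rdiv y x * rdiv d c.
Proof.
move=> cZ dZ; symmetry; apply: (proj1 (rdivP _ _ _)).
by rewrite mul_center ?rdivK //; exact: center_rdiv.
Qed.

Lemma coset_id x : coset x x.
Proof. by exists 1; [exact: center1 | rewrite mulx1]. Qed.

Lemma coset_mul x y : [set a * b | a in coset x & b in coset y] = coset (x * y).
Proof.
apply/seteqP; split=> [_ [_ [c cZ <-] [_ [d dZ <-] <-]] | _ [c cZ <-]].
  by exists (c * d); [exact: centerM | rewrite [RHS]mul_center].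
exists x; first exact: coset_id.
exists (y * c); first by exists c.
by rewrite -{1}(mulx1 x) mul_center ?mul1x //; exact: center1.
Qed.

Lemma coset_ldiv x y : [set ldiv a b | a in coset x & b in coset y] =
  coset (ldiv x y).
Proof.
apply/seteqP; split=> [_ [_ [c cZ <-] [_ [d dZ <-] <-]] | _ [c cZ <-]].
  by exists (ldiv c d); [exact: center_ldiv | rewrite ldiv_center].
exists x; first exact: coset_id.
exists (y * c); first by exists c.
rewrite -{1}(mulx1 x) ldiv_center //; last exact: center1.
by congr (_ * _); symmetry; apply/ldivP; rewrite mul1x.
Qed.

Lemma coset_rdiv x y : [set rdiv b a | b in coset y & a in coset x] =
  coset (rdiv y x).
Proof.
apply/seteqP; split=> [_ [_ [d dZ <-] [_ [c cZ <-] <-]] | _ [c cZ <-]].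
  by exists (rdiv d c); [exact: center_rdiv | rewrite rdiv_center].
exists (y * c); first by exists c.
exists x; first exact: coset_id.
rewrite -{1}(mulx1 x) rdiv_center //; last exact: center1.
by congr (_ * _); symmetry; apply/rdivP; rewrite mulx1.
Qed.

Lemma center_cosets_inj A B : sval A = sval B -> A = B.
Proof.
by case: A B => [A hA] [B hB] /= AB; subst B; congr exist; exact: Prop_irrelevance.
Qed.

Lemma cosets_mul_subproof A B :
  exists x, [set a * b | a in sval A & b in sval B] = coset x.
Proof.
by case: A B => [A [x Ax]] [B [y By]]; exists (x * y); rewrite /= Ax By coset_mul.
Qed.

Lemma cosets_ldiv_subproof A B :
  exists x, [set ldiv a b | a in sval A & b in sval B] = coset x.
Proof.
by case: A B => [A [x Ax]] [B [y By]]; exists (ldiv x y); rewrite /= Ax By coset_ldiv.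
Qed.

Lemma cosets_rdiv_subproof B A :
  exists x, [set rdiv b a | b in sval B & a in sval A] = coset x.
Proof.
by case: A B => [A [x Ax]] [B [y By]]; exists (rdiv y x); rewrite /= Ax By coset_rdiv.
Qed.

Definition cosets_mul A B : center_cosets Q :=
  exist _ _ (cosets_mul_subproof A B).
Definition cosets_ldiv A B : center_cosets Q :=
  exist _ _ (cosets_ldiv_subproof A B).
Definition cosets_rdiv B A : center_cosets Q :=
  exist _ _ (cosets_rdiv_subproof B A).
Definition cosets_one : center_cosets Q :=
  exist _ (coset 1) (ex_intro _ 1 erefl).

Lemma cosets_mul1x : left_id cosets_one cosets_mul.
Proof.
by case=> [A [x Ax]]; apply: center_cosets_inj; rewrite /= Ax coset_mul mul1x.
Qed.

Lemma cosets_mulx1 : right_id cosets_one cosets_mul.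
Proof.
by case=> [A [x Ax]]; apply: center_cosets_inj; rewrite /= Ax coset_mul mulx1.
Qed.

Lemma cosets_ldivP A B C : cosets_mul A C = B <-> C = cosets_ldiv A B.
Proof.
case: (svalP A) (svalP B) (svalP C) => [a Aa] [b Bb] [x Cx].
split=> [<-|->]; apply: center_cosets_inj; rewrite /=.
  by rewrite Aa Cx coset_mul coset_ldiv mulKl.
by rewrite Aa Bb coset_ldiv coset_mul ldivK.
Qed.

Lemma cosets_rdivP A B C : cosets_mul C A = B <-> C = cosets_rdiv B A.
Proof.
case: (svalP A) (svalP B) (svalP C) => [a Aa] [b Bb] [x Cx].
split=> [<-|->]; apply: center_cosets_inj; rewrite /=.
  by rewrite Aa Cx coset_mul coset_rdiv mulrK.
by rewrite Aa Bb coset_rdiv coset_mul rdivK.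
Qed.

Definition center_quotient : loop :=
  Loop cosets_mul1x cosets_mulx1 cosets_ldivP cosets_rdivP.

End CenterQuotient.

Definition two_nilpotent (Q : loop) : Prop := abelian_group (center_quotient Q).

Inductive polynomial (Q : loop) (n : nat) : Type :=
  | PVar of 'I_n
  | PConst of Q
  | POne
  | PMul of polynomial Q n & polynomial Q n
  | PLdiv of polynomial Q n & polynomial Q n
  | PRdiv of polynomial Q n & polynomial Q n.

Fixpoint peval (Q : loop) (n : nat) (p : polynomial Q n) (a : 'I_n -> Q) : Q :=
  match p with
  | PVar i => a i
  | PConst c => c
  | POne => 1
  | PMul p1 p2 => peval p1 a * peval p2 a
  | PLdiv p1 p2 => ldiv (peval p1 a) (peval p2 a)
  | PRdiv p1 p2 => rdiv (peval p1 a) (peval p2 a)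
  end.

Definition absorbing (Q : loop) (n : nat) (p : polynomial Q n)
    (e : 'I_n -> Q) (e0 : Q) : Prop :=
  forall a : 'I_n -> Q, (exists i, a i = e i) -> peval p a = e0.

Definition constant_polynomial (Q : loop) (n : nat) (p : polynomial Q n) : Prop :=
  exists c : Q, forall a : 'I_n -> Q, peval p a = c.

Definition supernilpotent (k : nat) (Q : loop) : Prop :=
  forall n : nat, (k < n)%N ->
  forall (p : polynomial Q n) (e : 'I_n -> Q) (e0 : Q),
    absorbing p e e0 -> constant_polynomial p.

(* Main.v *)
(* A loop whose quotient by the center V is an abelian group G is given by a
   normalised cocycle f : G -> G -> V.  The associators and commutators are
   expressed by f; the Moufang identity and the pentagon identity make the
   associator an alternating trilinear map, and then the commutator is quadratic
   in each argument.  Consider 4-dimensional cubes in the loop whose projection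
   to G is affine and whose V-component has fourth difference equal to the third
   difference of f(X, x4), where X is the bottom face and x4 the last edge.
   These cubes contain the constants and the cubes that vary one coordinate, and
   they are closed under the loop operations because the central defect of
   (Xu)(Yv) = (XY)(uv) has degree two in (X, Y).  In such a cube fifteen equal
   vertices force the sixteenth to be equal to them, so a polynomial absorbing in
   four or more variables is constant. *)
From HB Require Import structures.
From mathcomp Require Import all_boot ssralg ssrint.
From mathcomp Require Import boolp classical_sets.
Require Import Defs.

Set Implicit Arguments.
Unset Strict Implicit.
Unset Printing Implicit Defensive.

Import GRing.Theory.
Local Open Scope ring_scope.

(* Reflexive decision procedure for identities in abelian groups: two formal
   sums are equal as soon as the integer coefficients of all atoms agree. *)
Inductive zexp := ZVar of nat | ZZero | ZOpp of zexp | ZAdd of zexp & zexp.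

Fixpoint zeval (V : zmodType) (env : seq V) (e : zexp) : V :=
  match e with
  | ZVar i => env`_i
  | ZZero => 0
  | ZOpp e1 => - zeval env e1
  | ZAdd e1 e2 => zeval env e1 + zeval env e2
  end.

Fixpoint zcoef (e : zexp) (i : nat) : int :=
  match e with
  | ZVar j => (j == i)%:Z
  | ZZero => 0
  | ZOpp e1 => - zcoef e1 i
  | ZAdd e1 e2 => zcoef e1 i + zcoef e2 i
  end.

Lemma zevalE (V : zmodType) (env : seq V) e :
  zeval env e = \sum_(i < size env) env`_i *~ zcoef e i.
Proof.
elim: e => [j||e IH|e1 IH1 e2 IH2] /=.
- have [ltj|gej] := ltnP j (size env).
    rewrite (bigD1 (Ordinal ltj)) //= eqxx mulr1z big1 ?addr0 // => i ij.
    by rewrite (_ : (j == i) = false) // eq_sym; exact: negPf.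
  rewrite nth_default // big1 // => i _.
  by rewrite (_ : (j == i) = false) // gtn_eqF // (leq_trans (ltn_ord i)).
- by rewrite big1.
- by rewrite IH -sumrN; apply: eq_bigr => i _; rewrite mulrNz.
- by rewrite IH1 IH2 -big_split; apply: eq_bigr => i _; rewrite mulrzDr.
Qed.

Lemma zeval_eq (V : zmodType) (env : seq V) e1 e2 :
  all (fun i => zcoef e1 i == zcoef e2 i) (iota 0 (size env)) ->
  zeval env e1 = zeval env e2.
Proof.
move=> /allP e12; rewrite !zevalE; apply: eq_bigr => i _.
by rewrite (eqP (e12 i _)) // mem_iota /=.
Qed.

(* Atoms are compared up to unification, since rewriting leaves convertible but
   syntactically different canonical structures in them. *)
Ltac zlookup env x :=
  match env with
  | ?y :: _ => let _ := match goal with _ => unify x y end in constr:(O)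
  | _ :: ?env' => let n := zlookup env' x in constr:(S n)
  end.

Ltac zatoms env t :=
  lazymatch t with
  | @GRing.add _ ?a ?b => let env' := zatoms env a in zatoms env' b
  | @GRing.opp _ ?a => zatoms env a
  | @GRing.zero _ => env
  | _ => match env with
         | _ => let _ := zlookup env t in env
         | _ => constr:(t :: env)
         end
  end.

Ltac zreify env t :=
  lazymatch t with
  | @GRing.add _ ?a ?b =>
      let a' := zreify env a in let b' := zreify env b in constr:(ZAdd a' b')
  | @GRing.opp _ ?a => let a' := zreify env a in constr:(ZOpp a')
  | @GRing.zero _ => constr:(ZZero)
  | _ => let n := zlookup env t in constr:(ZVar n)
  end.

Ltac zmodule V :=
  lazymatch goal with
  | |- @eq _ ?a ?b =>
      let env := zatoms (@nil (GRing.Zmodule.sort V)) a in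
      let env := zatoms env b in
      let a' := zreify env a in
      let b' := zreify env b in
      refine (@zeval_eq V env a' b' _); vm_compute; reflexivity
  end.

Lemma eq_addr (V : zmodType) (a b a' b' : V) : a = b -> a' = b' -> a + a' = b + b'.
Proof. by move=> -> ->. Qed.

Lemma eq_oppr (V : zmodType) (a b : V) : a = b -> - a = - b.
Proof. by move=> ->. Qed.

(** Deduces a goal from a linear relation [l = r], leaving an identity of abelian groups for
    [zmodule]. *)
Lemma eq_combination (V : zmodType) (a b l r : V) :
  l = r -> a - b = l - r -> a = b.
Proof. by move=> ->; rewrite subrr => /subr0_eq. Qed.

(** * Associators and commutators of a normalised cocycle *)

Section Cocycle.
Variables (G V : zmodType) (f : G -> G -> V).
Hypotheses (f0x : forall x, f 0 x = 0) (fx0 : forall x, f x 0 = 0).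

(* With (v, g)(w, h) = (v + w + f g h, g + h), this is the central element
   relating (xy)z to x(yz). *)
Definition assoc x y z := f x y + f (x + y) z - f y z - f x (y + z).
Definition comm x y := f x y - f y x.

Local Notation A := assoc.

Lemma assoc0l y z : A 0 y z = 0.
Proof. by rewrite /assoc !f0x !add0r; zmodule V. Qed.

Lemma assoc0m x z : A x 0 z = 0.
Proof. by rewrite /assoc fx0 f0x addr0 !add0r; zmodule V. Qed.

Lemma assoc0r x y : A x y 0 = 0.
Proof. by rewrite /assoc !fx0 !addr0; zmodule V. Qed.

(** Up to sign [A] is the coboundary of [f]; this is its 3-cocycle condition. *)
Lemma assoc_pentagon x y z w :
  A y z w + A x (y + z) w + A x y z = A (x + y) z w + A x y (z + w).
Proof. by rewrite /assoc !addrA; zmodule V. Qed.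

Lemma commDr x y z :
  comm x (y + z) = comm x y + comm x z - (A x y z - A y x z + A y z x).
Proof.
rewrite /assoc /comm [z + x]addrC [y + x]addrC.
zmodule V.
Qed.

(** Going from ((xy)x)z through (xy)(xz) to x(y(xz)) costs one associator per step. *)
Hypothesis assoc_moufang :
  forall x y z, A (x + y) x z + A x y (x + z) = 0.

Lemma assoc_flexible x y : A x y x = 0.
Proof. by have := assoc_moufang x y 0; rewrite assoc0r add0r addr0. Qed.

(** One side of the pentagon at [x, y, x, z] is the Moufang sum, which vanishes. *)
Lemma assoc_shift x y z : A x (x + y) z = - A y x z.
Proof.
have := assoc_pentagon x y x z; have := assoc_moufang x y z.
rewrite assoc_flexible [y + x]addrC => m p.
apply: (eq_combination (eq_addr p m)); zmodule V.
Qed.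

Lemma assoc_oppl x y z : A (- x) (x + y) z = - A x y z.
Proof.
(* The left inverse property. *)
have inv w : A (- x) x w = 0.
  have := assoc_shift x (- x) w.
  by rewrite subrr assoc0m => /esym/eqP; rewrite oppr_eq0 => /eqP.
have := assoc_pentagon (- x) x y z.
rewrite !inv addNr assoc0l => p.
apply: (eq_combination p); zmodule V.
Qed.

Lemma assocDl x y z : A (x + y) y z = A x y z.
Proof.
have := assoc_shift (x + y) (- x) z.
by rewrite assoc_oppl opprK addrAC subrr add0r.
Qed.

Lemma assocC12 x y z : A y x z = - A x y z.
Proof.
have := assoc_shift y (x - y) z.
by rewrite [y + _]addrC -[A (x - y) y z]assocDl subrK.
Qed.

Lemma assocDr x y z : A x y (x + z) = A x y z.
Proof.
have m := assoc_moufang x y z.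
rewrite [x + y]addrC assocDl assocC12 in m.
apply: (eq_combination m); zmodule V.
Qed.

Lemma assocDmr x y z : A x y (y + z) = A x y z.
Proof. by rewrite assocC12 assocDr -assocC12. Qed.

Lemma assocC23 x y z : A x z y = - A x y z.
Proof.
have shift a b c : A (c + a) b c = A a b c.
  have := assoc_pentagon c a b c; rewrite assoc_flexible [b + c]addrC assocDr.
  by move=> p; apply: (eq_combination (esym p)); zmodule V.
have inv a b : A a b (- b) = 0.
  by rewrite -assocDmr subrr assoc0r.
(* Only [A x y z] and [A x (y + z) (- z)] survive here, and the latter equals [A x z y]. *)
have := assoc_pentagon x y z (- z); rewrite inv subrr assoc0r.
rewrite -[A x (y + z) _]assocDmr [y + z + - z]addrK.
rewrite assocC12 shift -assocC12 => p.
have := inv (x + y) z => q.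
apply: (eq_combination (eq_addr p q)); zmodule V.
Qed.

(* The defect [L] of additivity in the first argument is symmetric in its four
   arguments but alternating in the last two; hence [2 L = 0], while the
   pentagon identity gives [3 L = 0]. *)
Lemma assoc_addl x y z w : A (x + y) z w = A x z w + A y z w.
Proof.
pose L x y z w := A (x + y) z w - A x z w - A y z w.
have LC a b c d : L a b c d = L b a c d.
  by rewrite /L [b + a]addrC; zmodule V.
have LN a b c d : L a b d c = - L a b c d.
  by rewrite /L ![A _ d c]assocC23; zmodule V.
have L3 a b c d : L a b c d + L c d a b + L b c a d = 0.
  have p := assoc_pentagon a b c d.
  have e1 : A a (b + c) d = - A (b + c) a d by exact: assocC12.
  have e2 : A a b (c + d) = A (c + d) a b.
    by rewrite assocC23 assocC12 opprK.
  rewrite e1 e2 in p; rewrite /L.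
  have h1 := assocC12 a b d; have h2 := assocC12 a c d.
  have h3 : A c a b = A a b c by rewrite assocC12 assocC23 opprK.
  have h4 : A d a b = A a b d by rewrite assocC12 assocC23 opprK.
  rewrite h1 h2 h3 h4.
  by apply: (eq_combination (esym p)); zmodule V.
(* Two instances of [L3] share two of their three terms, by symmetry in the first two arguments. *)
have L13 a b c d : L a b c d = L c b a d.
  have h := eq_addr (L3 c d a b) (eq_oppr (L3 a d c b)).
  rewrite [L d a _ _]LC [L d c _ _]LC in h.
  by apply: (eq_combination h); zmodule V.
have L14 a b c d : L a b c d = L d b c a.
  by rewrite LN L13 LN opprK.
have L2 a b c d : L a b c d + L a b c d = 0.
  by rewrite {1}L13 L14 L13 LN addNr.
have L0 : L x y z w = 0.
  have e1 : L z w x y = L x y z w by rewrite L13 LC L14 LC.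
  have e2 : L y z x w = L x y z w by rewrite L13 LC L13 LC.
  by have := L3 x y z w; rewrite e1 e2 L2 add0r.
by apply: (eq_combination L0); rewrite /L; zmodule V.
Qed.

Lemma assoc_addm x y z w : A x (y + z) w = A x y w + A x z w.
Proof.
by rewrite assocC12 assoc_addl [A y _ _]assocC12 [A z _ _]assocC12; zmodule V.
Qed.

Lemma assoc_addr x y z w : A x y (z + w) = A x y z + A x y w.
Proof.
by rewrite assocC23 assoc_addm [A x z _]assocC23 [A x w _]assocC23; zmodule V.
Qed.

(** Skew-symmetry merges the three associators of [commDr]; the defect is now bilinear in [y] and
    [z]. *)
Lemma comm_addr x y z :
  comm x (y + z) = comm x y + comm x z - (A x y z + A x y z + A x y z).
Proof.
have e : A y z x = A x y z by rewrite assocC23 assocC12 opprK.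
by rewrite commDr [A y x z]assocC12 e; zmodule V.
Qed.

(** * Third differences, which kill maps of degree at most two *)

Definition diff3 (W : zmodType) (h : bool -> bool -> bool -> W) : W :=
  (h true true true - h false true true - h true false true - h true true false)
  + (h true false false + h false true false + h false false true)
  - h false false false.

Lemma eq_diff3 (W : zmodType) (h h' : bool -> bool -> bool -> W) :
  (forall a b c, h a b c = h' a b c) -> diff3 h = diff3 h'.
Proof. by move=> e; rewrite /diff3 !e. Qed.

(* Only the values of [x] at 0, ..., 4 matter: a base point and the edges of an
   affine cube in directions [a], [b], [c] and, for [cell], [d]. *)
Definition face (x : nat -> G) (a b c : bool) : G :=
  x 0 + x 1 *+ a + x 2 *+ b + x 3 *+ c.

Lemma faceD x y a b c :
  face x a b c + face y a b c = face (fun i => x i + y i) a b c.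
Proof.
rewrite /face; case: a b c => [] [] []; rewrite ?mulr1n ?mulr0n; zmodule G.
Qed.

Lemma diff3_linear (L : G -> V) (x : nat -> G) :
  (forall u v, L (u + v) = L u + L v) ->
  diff3 (fun a b c => L (face x a b c)) = 0.
Proof.
move=> LD; have L0 : L 0 = 0.
  by apply: (@addrI _ (L 0)); rewrite -LD !addr0.
rewrite /diff3 /face ?mulr1n ?mulr0n !LD L0; zmodule V.
Qed.

Lemma diff3_bilinear (B : G -> G -> V) (x y : nat -> G) :
  (forall u v w, B (u + v) w = B u w + B v w) ->
  (forall u v w, B u (v + w) = B u v + B u w) ->
  diff3 (fun a b c => B (face x a b c) (face y a b c)) = 0.
Proof.
move=> Bl Br; have B0l u : B 0 u = 0.
  by apply: (@addrI _ (B 0 u)); rewrite -Bl !addr0.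
have B0r u : B u 0 = 0.
  by apply: (@addrI _ (B u 0)); rewrite -Br !addr0.
rewrite /diff3 /face ?mulr1n ?mulr0n !(Bl, Br) !(B0l, B0r); zmodule V.
Qed.

Lemma diff3_comm u x : diff3 (fun a b c => comm u (face x a b c)) = 0.
Proof.
have c0 : comm u 0 = 0 by rewrite /comm f0x fx0 subrr.
rewrite /diff3 /face ?mulr1n ?mulr0n !comm_addr !assoc_addm c0 !assoc0r !assoc0m.
zmodule V.
Qed.

(* The left-hand side is [f u v] plus the central element relating (Xu)(Yv) to
   (XY)(uv). *)
Lemma medial_defect X u Y v :
  f (X + u) (Y + v) + f X u + f Y v - f X Y - f (X + Y) (u + v) =
  f u v + comm u Y + A X u Y + A X u v - A u Y v + A Y u v - A X Y u - A X Y v.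
Proof.
apply: (@eq_trans _ _ (f u v + comm u Y + A X u (Y + v) - A u Y v + A Y u v
                       - A X Y (u + v))); last first.
  by rewrite !assoc_addr; zmodule V.
rewrite /comm /assoc [u + (Y + v)]addrCA [u + Y]addrC; zmodule V.
Qed.

(** With [X] and [Y] running over faces, the right-hand side of [medial_defect] has degree at most
    two, so its third difference is zero. *)
Lemma diff3_medial x y u v :
  diff3 (fun a b c => f (face x a b c + u) (face y a b c + v)) =
  diff3 (fun a b c => f (face x a b c) (face y a b c))
  + diff3 (fun a b c => f (face x a b c + face y a b c) (u + v))
  - diff3 (fun a b c => f (face x a b c) u)
  - diff3 (fun a b c => f (face y a b c) v).
Proof.
have h1 := diff3_comm u y.
have h2 : diff3 (fun a b c => A (face x a b c) u (face y a b c)) = 0.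
  by apply: (@diff3_bilinear (fun s t => A s u t)) => *;
    rewrite ?assoc_addl ?assoc_addr.
have h3 w : diff3 (fun a b c => A (face x a b c) (face y a b c) w) = 0.
  by apply: (@diff3_bilinear (fun s t => A s t w)) => *;
    rewrite ?assoc_addl ?assoc_addm.
have h4 z : diff3 (fun a b c => A (face z a b c) u v) = 0.
  by apply: (@diff3_linear (fun s => A s u v)) => *; rewrite assoc_addl.
have h5 : diff3 (fun a b c => A u (face y a b c) v) = 0.
  by apply: (@diff3_linear (fun s => A u s v)) => *; rewrite assoc_addm.
pose m a b c : V := f (face x a b c + u) (face y a b c + v)
  + f (face x a b c) u + f (face y a b c) v
  - f (face x a b c) (face y a b c) - f (face x a b c + face y a b c) (u + v).
have m0 : diff3 m = 0.
  rewrite (eq_diff3 (fun a b c => medial_defect _ _ _ _)).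
  have := eq_addr (eq_addr (eq_addr (eq_addr h1 h2) (h4 x)) (eq_oppr h5))
    (eq_addr (h4 y) (eq_oppr (eq_addr (h3 u) (h3 v)))).
  by move=> h; apply: (eq_combination h); rewrite /diff3; zmodule V.
by apply: (eq_combination m0); rewrite /m /diff3; zmodule V.
Qed.

(** * Four-dimensional cubes and their closure properties *)

Definition diff4 (W : zmodType) (h : bool -> bool -> bool -> bool -> W) : W :=
  diff3 (h true) - diff3 (h false).

Definition cell (x : nat -> G) (d a b c : bool) : G := face x a b c + x 4 *+ d.

Definition twist (x : nat -> G) : V := diff3 (fun a b c => f (face x a b c) (x 4)).

Lemma cellD x y d a b c :
  cell x d a b c + cell y d a b c = cell (fun i => x i + y i) d a b c.
Proof. by rewrite /cell -faceD mulrnDl addrACA. Qed.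

(** The top faces are the bottom faces shifted by [x 4] and [y 4], so [diff3_medial] applies. The
    additivity defect of [twist] thus matches the cocycle term of a product. *)
Lemma diff4_cocycle x y :
  diff4 (fun d a b c => f (cell x d a b c) (cell y d a b c)) =
  twist (fun i => x i + y i) - twist x - twist y.
Proof.
rewrite /diff4 /cell /twist diff3_medial mulr1n mulr1n.
rewrite (eq_diff3 (fun a b c => congr1 (f ^~ _) (faceD x y a b c))).
have -> : diff3 (fun a b c => f (face x a b c + x 4 *+ false)
                               (face y a b c + y 4 *+ false)) =
          diff3 (fun a b c => f (face x a b c) (face y a b c)).
  by apply: eq_diff3 => a b c; rewrite !mulr0n !addr0.
zmodule V.
Qed.

Definition cube (g : bool -> bool -> bool -> bool -> G)
    (z : bool -> bool -> bool -> bool -> V) : Prop :=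
  exists2 x, (forall d a b c, g d a b c = cell x d a b c) & diff4 z = twist x.

Lemma diff4_sum z z' g g' x y :
  (forall d a b c, g d a b c = cell x d a b c) ->
  (forall d a b c, g' d a b c = cell y d a b c) ->
  diff4 (fun d a b c => z d a b c + z' d a b c + f (g d a b c) (g' d a b c)) =
  diff4 z + diff4 z' + (twist (fun i => x i + y i) - twist x - twist y).
Proof.
move=> gx gy; rewrite -diff4_cocycle.
have -> : diff4 (fun d a b c => f (cell x d a b c) (cell y d a b c)) =
          diff4 (fun d a b c => f (g d a b c) (g' d a b c)).
  by congr (_ - _); apply: eq_diff3 => a b c; rewrite gx gy.
by rewrite /diff4 /diff3; zmodule V.
Qed.

Lemma cubeM g g' z z' : cube g z -> cube g' z' ->
  cube (fun d a b c => g d a b c + g' d a b c)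
       (fun d a b c => z d a b c + z' d a b c + f (g d a b c) (g' d a b c)).
Proof.
move=> [x gx zx] [y gy zy]; exists (fun i => x i + y i).
  by move=> d a b c; rewrite gx gy cellD.
by rewrite (diff4_sum _ _ gx gy) zx zy; zmodule V.
Qed.

(** Serves left division: the base point and edges of the quotient are differences, and [diff4_sum]
    is solved for [diff4 z']. *)
Lemma cube_cancell g g' z z' : cube g z ->
  cube (fun d a b c => g d a b c + g' d a b c)
       (fun d a b c => z d a b c + z' d a b c + f (g d a b c) (g' d a b c)) ->
  cube g' z'.
Proof.
move=> [x gx zx] [y gy zy]; pose y' i := y i - x i.
have xy' : (fun i => x i + y' i) = y.
  by apply/funext => i; rewrite /y' addrC subrK.
have gy' d a b c : g' d a b c = cell y' d a b c.
  apply: (@addrI _ (cell x d a b c)).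
  by rewrite cellD xy' -gx gy.
exists y' => //; move: zy; rewrite (diff4_sum _ _ gx gy') zx xy' => h.
by apply: (eq_combination h); zmodule V.
Qed.

Lemma cube_cancelr g g' z z' : cube g' z' ->
  cube (fun d a b c => g d a b c + g' d a b c)
       (fun d a b c => z d a b c + z' d a b c + f (g d a b c) (g' d a b c)) ->
  cube g z.
Proof.
move=> [x gx zx] [y gy zy]; pose y' i := y i - x i.
have xy' : (fun i => y' i + x i) = y by apply/funext => i; rewrite subrK.
have gy' d a b c : g d a b c = cell y' d a b c.
  apply: (@addIr _ (cell x d a b c)).
  by rewrite cellD xy' -gx gy.
exists y' => //; move: zy; rewrite (diff4_sum _ _ gy' gx) zx xy' => h.
by apply: (eq_combination h); zmodule V.
Qed.

Lemma cube_cst u w : cube (fun _ _ _ _ => u) (fun _ _ _ _ => w).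
Proof.
exists (fun i => if i is 0 then u else 0) => [d a b c|].
  by rewrite /cell /face !mul0rn !addr0.
rewrite /twist /diff4 /diff3 !fx0; zmodule V.
Qed.

Lemma cube_var (k : 'I_4) u u' w w' :
  let pick T (t t' : T) d a b c := if nth d [:: a; b; c] k then t else t' in
  cube (pick G u u') (pick V w w').
Proof.
(* Direction [k] is stored at [k.+1], and [k = 3] reads the default [d]. With at most one nonzero
   edge, both [diff4] and [twist] vanish. *)
exists (fun i => if i is 0 then u' else if i == k.+1 then u - u' else 0).
  case: k => [] [|[|[|[|//]]]] /= _ d a b c; rewrite /cell /face /= !mul0rn !addr0.
  - by case: a; rewrite ?mulr1n ?mulr0n ?addr0 // addrC subrK.
  - by case: b; rewrite ?mulr1n ?mulr0n ?addr0 // addrC subrK.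
  - by case: c; rewrite ?mulr1n ?mulr0n ?addr0 // addrC subrK.
  - by case: d; rewrite ?mulr1n ?mulr0n ?addr0 // addrC subrK.
case: k => [] [|[|[|[|//]]]] /= _;
  rewrite /diff4 /twist /diff3 /face /= ?fx0 ?mul0rn ?addr0; zmodule V.
Qed.

(** The neighbours of the base vertex force all edges to be zero. Then [twist] is zero, and the
    vanishing fourth difference determines the last value of [z]. *)
Lemma cube_corner g z g0 z0 : cube g z ->
  (forall d a b c, ~~ [&& d, a, b & c] -> g d a b c = g0 /\ z d a b c = z0) ->
  g true true true true = g0 /\ z true true true true = z0.
Proof.
move=> [x gx zx] gz.
have gE d a b c : ~~ [&& d, a, b & c] -> cell x d a b c = g0.
  by move=> /gz [<- _]; rewrite gx.
have x0 : x 0 = g0.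
  by have := gE false false false false isT; rewrite /cell /face !addr0.
have x1 : x 1 = 0.
  have := gE false true false false isT.
  by rewrite /cell /face !addr0 x0 -[RHS]addr0 => /addrI.
have x2 : x 2 = 0.
  have := gE false false true false isT.
  by rewrite /cell /face !addr0 x0 -[RHS]addr0 => /addrI.
have x3 : x 3 = 0.
  have := gE false false false true isT.
  by rewrite /cell /face !addr0 x0 -[RHS]addr0 => /addrI.
have x4 : x 4 = 0.
  have := gE true false false false isT.
  by rewrite /cell /face !addr0 x0 -[RHS]addr0 => /addrI.
split; first by rewrite gx /cell /face x0 x1 x2 x3 x4 !mul0rn !addr0.
move: zx; rewrite /diff4 /twist /diff3 x4 !fx0.
have zE d a b c : ~~ [&& d, a, b & c] -> z d a b c = z0 by case/gz.
move: (z true true true true) => w; rewrite !zE // => h.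
by apply: (eq_combination h); zmodule V.
Qed.

End Cocycle.

(** * Supernilpotence of Moufang central extensions *)

Section CentralExtension.
Variables (Q : loop) (G V : zmodType) (f : G -> G -> V).
Variables (pi : Q -> G) (zeta : Q -> V).
Hypotheses (f0x : forall x, f 0 x = 0) (fx0 : forall x, f x 0 = 0).
Hypothesis piM : forall x y, pi (mul x y) = pi x + pi y.
Hypothesis zetaM : forall x y, zeta (mul x y) = zeta x + zeta y + f (pi x) (pi y).
Hypothesis pi_surj : forall g, exists x, pi x = g.
Hypothesis pi_zeta_inj : forall x y, pi x = pi y -> zeta x = zeta y -> x = y.
Hypothesis hM : moufang Q.

Lemma cocycle_moufang x y z : assoc f (x + y) x z + assoc f x y (x + z) = 0.
Proof.
have [[a <-] [b <-] [c <-]] := And3 (pi_surj x) (pi_surj y) (pi_surj z).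
have := congr1 zeta (hM a b c); rewrite !zetaM !piM => h.
by rewrite /assoc; apply: (eq_combination (esym h)); zmodule V.
Qed.

Definition loop_cube (q : bool -> bool -> bool -> bool -> Q) : Prop :=
  cube f (fun d a b c => pi (q d a b c)) (fun d a b c => zeta (q d a b c)).

Lemma eq_loop_cube q q' :
  (forall d a b c, q d a b c = q' d a b c) -> loop_cube q -> loop_cube q'.
Proof.
move=> e; suff -> : q = q' by [].
by apply/funext => d; apply/funext => a; apply/funext => b; apply/funext => c.
Qed.

Lemma loop_cubeE q q' :
  loop_cube (fun d a b c => mul (q d a b c) (q' d a b c)) =
  cube f (fun d a b c => pi (q d a b c) + pi (q' d a b c))
    (fun d a b c => zeta (q d a b c) + zeta (q' d a b c)
                    + f (pi (q d a b c)) (pi (q' d a b c))).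
Proof.
rewrite /loop_cube; congr (cube f _ _);
  apply/funext => d; apply/funext => a; apply/funext => b; apply/funext => c.
- exact: piM.
- exact: zetaM.
Qed.

(* All the variables from the fourth on are switched simultaneously by [d]. *)
Lemma loop_cube_peval n (p : polynomial Q n) (u v : 'I_n -> Q) :
  loop_cube (fun d a b c =>
    peval p (fun i => if nth d [:: a; b; c] i then u i else v i)).
Proof.
have cm := cocycle_moufang.
elim: p => [i|q||p IHp p' IHp'|p IHp p' IHp'|p IHp p' IHp'] /=.
- pose k : 'I_4 := inord (minn i 3).
  have kE : k = minn i 3 :> nat by rewrite inordK // ltnS geq_minr.
  have := cube_var fx0 k (pi (u i)) (pi (v i)) (zeta (u i)) (zeta (v i)).
  have e d a b c : nth d [:: a; b; c] k = nth d [:: a; b; c] i.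
    rewrite kE /minn; case: ltnP => // i3.
    by rewrite !nth_default.
  rewrite /loop_cube /=; congr (cube f _ _);
    apply/funext => d; apply/funext => a; apply/funext => b; apply/funext => c;
    by rewrite e; case: ifP.
- exact: cube_cst.
- exact: cube_cst.
- by rewrite loop_cubeE; exact: cubeM.
(* Multiplying the quotient back by the divisor gives the dividend, a cube by induction. *)
- apply: (@cube_cancell _ _ f f0x fx0 cm _ _ _ _ IHp).
  rewrite -loop_cubeE; apply: eq_loop_cube IHp' => d a b c.
  by rewrite ldivK.
- apply: (@cube_cancelr _ _ f f0x fx0 cm _ _ _ _ IHp').
  rewrite -loop_cubeE; apply: eq_loop_cube IHp => d a b c.
  by rewrite rdivK.
Qed.

Lemma central_extension_supernilpotent : supernilpotent 3 Q.
Proof.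
move=> n n3 p e e0 ab; exists e0 => u.
have hc := loop_cube_peval p u e.
have corner : peval p u = peval p (fun i => if nth true [:: true; true; true] i
                                          then u i else e i).
  congr (peval p _); apply/funext => i.
  by rewrite (_ : [:: true; true; true] = nseq 3 true) // nth_nseq if_same.
rewrite corner.
have [] // := cube_corner (g0 := pi e0) (z0 := zeta e0) fx0 hc.
  move=> d a b c dabc; suff -> : peval p (fun i =>
    if nth d [:: a; b; c] i then u i else e i) = e0 by [].
  (* A switch that is off sends variable 3, 0, 1 or 2, for [d], [a], [b], [c], to its value in
     [e]. *)
  apply: ab; move: dabc; rewrite !negb_and => /or4P[] /negPf ->.
  - by exists (Ordinal n3).
  - by exists (Ordinal (ltn_trans (isT : 0 < 3)%N n3)).
  - by exists (Ordinal (ltn_trans (isT : 1 < 3)%N n3)).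
  - by exists (Ordinal (ltn_trans (isT : 2 < 3)%N n3)).
exact: pi_zeta_inj.
Qed.

End CentralExtension.

(** * Abelian loops, and the center, as abelian groups *)

Section AbelianLoop.
Variables (L : loop) (hL : abelian_group L).

(** The proof is an argument of the type, so that the group instance can draw its axioms from it. *)
Definition abelian_loop of abelian_group L : Type := L.
Local Notation V := (abelian_loop hL).

Lemma abelian_loopNx : left_inverse (@one L) (fun x => ldiv x one) (@mul L).
Proof. by move=> x; rewrite (proj2 hL) ldivK. Qed.

HB.instance Definition _ := gen_eqMixin V.
HB.instance Definition _ := gen_choiceMixin V.
HB.instance Definition _ := GRing.isZmodule.Build V
  (proj1 hL) (proj2 hL) (@mul1x L) abelian_loopNx.

End AbelianLoop.

Section CenterLoop.
Variable Q : loop.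
Local Notation Z := {c : Q | center c}.

Definition center_mul (c d : Z) : Z := exist _ _ (centerM (svalP c) (svalP d)).
Definition center_ld (c d : Z) : Z := exist _ _ (center_ldiv (svalP c) (svalP d)).
Definition center_rd (d c : Z) : Z := exist _ _ (center_rdiv (svalP c) (svalP d)).
Definition center_one : Z := exist _ _ (center1 Q).

Lemma center_inj (c d : Z) : sval c = sval d -> c = d.
Proof. by case: c d => [c hc] [d hd] /= cd; apply: eq_exist. Qed.

Lemma center_mul1x : left_id center_one center_mul.
Proof. by move=> c; apply: center_inj; exact: mul1x. Qed.

Lemma center_mulx1 : right_id center_one center_mul.
Proof. by move=> c; apply: center_inj; exact: mulx1. Qed.

Lemma center_ldivP a b x : center_mul a x = b <-> x = center_ld a b.
Proof.
split=> [<-|->]; apply: center_inj; [exact/esym/mulKl | exact: ldivK].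
Qed.

Lemma center_rdivP a b x : center_mul x a = b <-> x = center_rd b a.
Proof.
split=> [<-|->]; apply: center_inj; [exact/esym/Defs.mulrK | exact: rdivK].
Qed.

Definition center_loop : loop :=
  Loop center_mul1x center_mulx1 center_ldivP center_rdivP.

Lemma center_abelian : abelian_group center_loop.
Proof.
split=> [c d e|c d]; apply: center_inj => /=.
  by have [_ /(_ (sval d) (sval e))[]] := svalP c.
by have [cC _] := svalP c.
Qed.

End CenterLoop.

(** * Coordinates and cocycle of a 2-nilpotent loop *)

Section TwoNilpotent.
Variables (Q : loop) (h2 : two_nilpotent Q).

Local Notation G := (abelian_loop h2).
Local Notation V := (abelian_loop (center_abelian Q)).

Definition center_proj (x : Q) : G :=
  exist (fun A => exists y, A = coset y) (coset x) (ex_intro _ x erefl).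
Local Notation pi := center_proj.

Lemma center_projM x y : pi (mul x y) = pi x + pi y.
Proof. by apply: center_cosets_inj; rewrite /= coset_mul. Qed.

Lemma center_proj1 : pi one = 0.
Proof. exact: center_cosets_inj. Qed.

Lemma center_projP x y : pi x = pi y -> center (ldiv x y).
Proof.
move=> /(congr1 sval) /= xy; have : coset x y by rewrite xy; exact: coset_id.
by case=> c cZ <-; rewrite mulKl.
Qed.

(* Normalised at 0, so that the cocycle is normalised. *)
Definition section (g : G) : Q := if g == 0 then one else sval (cid (svalP g)).
Local Notation s := section.

Lemma section0 : s 0 = one.
Proof. by rewrite /s eqxx. Qed.

Lemma sectionK g : pi (s g) = g.
Proof.
rewrite /s; case: eqP => [->|_]; first exact: center_proj1.
by apply: center_cosets_inj => /=; rewrite -(svalP (cid (svalP g))).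
Qed.

Definition zeta (x : Q) : V :=
  exist _ (ldiv (s (pi x)) x) (center_projP (sectionK (pi x))).

Lemma cocycle_subproof g h : pi (s (g + h)) = pi (mul (s g) (s h)).
Proof. by rewrite center_projM !sectionK. Qed.

(** The factor set of the central extension for the chosen representatives. *)
Definition cocycle (g h : G) : V := exist _ _ (center_projP (cocycle_subproof g h)).

Lemma zetaK x : mul (s (pi x)) (sval (zeta x)) = x.
Proof. exact: ldivK. Qed.

Lemma cocycle0x g : cocycle 0 g = 0.
Proof.
apply: center_inj => /=; rewrite section0 mul1x add0r.
by apply/esym/ldivP; rewrite mulx1.
Qed.

Lemma cocyclex0 g : cocycle g 0 = 0.
Proof.
apply: center_inj => /=; rewrite section0 mulx1 addr0.
by apply/esym/ldivP; rewrite mulx1.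
Qed.

(** Each element is its representative times a central factor; gathering these factors leaves a
    product of representatives, which contributes the cocycle. *)
Lemma zetaM x y : zeta (mul x y) = zeta x + zeta y + cocycle (pi x) (pi y).
Proof.
apply: center_inj; apply: (@mulIl _ (s (pi (mul x y)))).
rewrite zetaK -{1}(zetaK x) -{1}(zetaK y) mul_center; try exact: svalP.
rewrite center_projM [_ + cocycle _ _]addrC.
(* [d] is central, so it associates with every pair. *)
have [_ _ cr] : [/\ True, True & forall c d : V,
  mul (s (pi x + pi y)) (mul (sval c) (sval d)) =
  mul (mul (s (pi x + pi y)) (sval c)) (sval d)].
  by split=> // c d; have [_ /(_ (s (pi x + pi y)) (sval c))[]] := svalP d.
by rewrite [RHS]cr [mul _ (sval (cocycle _ _))]ldivK.
Qed.

End TwoNilpotent.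

Theorem corollary6p5 (Q : loop) (hM : moufang Q) (h2 : two_nilpotent Q) :
  supernilpotent 3 Q.
Proof.
apply: (central_extension_supernilpotent (@cocycle0x _ h2) (@cocyclex0 _ h2)
  (@center_projM _ h2) (@zetaM _ h2) _ _ hM).
- by move=> g; exists (section g); exact: sectionK.
- by move=> x y pxy zxy; rewrite -(zetaK h2 x) -(zetaK h2 y) pxy zxy.
Qed.
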